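(* Let $n\ge 3$ and let $\mathcal{H}=(V,\mathcal{E})$ be a $5$-uniform hypergraph with $EI(\mathcal{H})=C_n$ such that every hyperedge of $\mathcal{H}$ is a $(3,2)$-hyperedge. Then $|\mathcal{E}|\ge\frac{2n}{3}$.
   Context: Hypergraphs $\mathcal{H}=(V,\mathcal{E})$ have no multiple hyperedges; isolated vertices are allowed. $\mathcal{H}$ is $5$-uniform if every hyperedge has exactly $5$ elements. The edge intersection hypergraph of $\mathcal{H}$ is $EI(\mathcal{H})=(V,\mathcal{E}^{EI})$ with $\mathcal{E}^{EI}=\{e_1\cap e_2: e_1,e_2\in\mathcal{E},\ e_1\ne e_2,\ |e_1\cap e_2|\ge 2\}$. $C_n$ is the cycle with vertex set $\{1,\dots,n\}$ and edges $\{i,i+1\}$, $i=1,\dots,n$ (vertices taken mod $n$); ''$EI(\mathcal{H})=C_n$'' means $V=\{1,\dots,n\}$ and $\mathcal{E}^{EI}$ is exactly the edge set of $C_n$. For $e\in\mathcal{E}$, a $k$-section of $e$ is a sequence $(i,i+1,\dots,i+k-1)$ of cyclically consecutive vertices with $\{i,\dots,i+k-1\}\subseteq e$, $i-1\notin e$, $i+k\notin e$ (mod $n$). A hyperedge $e$ is an $(l_1,\dots,l_t)$-hyperedge ($l_1\ge\dots\ge l_t$) if $e$ is the disjoint union of exactly $t$ sections, of cardinalities $l_1,\dots,l_t$. Thus a $(3,2)$-hyperedge consists of one $3$-section and one $2$-section. *)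

(* Defs.v *)
From mathcomp Require Import all_boot.

Set Implicit Arguments.
Unset Strict Implicit.
Unset Printing Implicit Defensive.

(* The vertex set is the whole type V, so isolated vertices are allowed. *)
Definition hypergraph (V : finType) := {set {set V}}.

Definition uniform (V : finType) (k : nat) (E : hypergraph V) : Prop :=
  forall e : {set V}, e \in E -> #|e| = k.

Definition EI (V : finType) (E : hypergraph V) : hypergraph V :=
  [set e1 :&: e2 | e1 in E, e2 in E & (e1 != e2) && (2 <= #|e1 :&: e2|)].

(* The vertex i of {1, ..., n} is the ordinal i - 1 of 'I_n, and ordS,
   ord_pred are the successor and the predecessor modulo n. *)
Definition cycle_graph (n : nat) : hypergraph 'I_n :=
  [set [set i; ordS i] | i : 'I_n].

(* {i, i + 1, ..., i + k - 1} modulo n. *)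
Definition cyclic_arc (n : nat) (i : 'I_n) (k : nat) : {set 'I_n} :=
  [set iter j (@ordS n) i | j : 'I_k].

(* When 0 < k, the vertices i, ..., i + k - 1 of a section are automatically
   distinct: otherwise they would exhaust 'I_n, and i - 1 would lie in e. *)
Definition is_section (n : nat) (e : {set 'I_n}) (i : 'I_n) (k : nat) : bool :=
  [&& 0 < k, cyclic_arc i k \subset e, ord_pred i \notin e
    & iter k (@ordS n) i \notin e].

(* e is an (l_1, ..., l_t)-hyperedge, for l = [:: l_1; ...; l_t]; the vertex
   s j is the first one of the j-th section. *)
Definition is_hyperedge_of_type (n : nat) (l : seq nat) (e : {set 'I_n}) : Prop :=
  sorted geq l /\
  exists s : 'I_(size l) -> 'I_n,
    [/\ forall j, is_section e (s j) (nth 0 l j),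
        forall j k, j != k ->
          [disjoint cyclic_arc (s j) (nth 0 l j) & cyclic_arc (s k) (nth 0 l k)]
      & e = \bigcup_j cyclic_arc (s j) (nth 0 l j)].

(* Main.v *)
Require Import Defs.
From mathcomp Require Import all_boot all_order all_algebra.

(** Double count the pairs (i, e) such that the hyperedge e contains the cycle
    edge {i, i+1}. Every cycle edge is the intersection of two distinct
    hyperedges, so it lies in at least two; an l-section contains only l - 1
    cycle edges and no cycle edge joins two sections, so a (3,2)-hyperedge
    contains at most 2 + 1 = 3 of them. Hence 2n <= 3|E|. *)

Local Open Scope ring_scope.

(** The cycle edge {i, i+1} is encoded by its first vertex i. *)
Definition edge_starts {n : nat} (e : {set 'I_n}) : {set 'I_n} :=
  [set i | (i \in e) && (ordS i \in e)].

Lemma card_cyclic_arc (n : nat) (i : 'I_n) (k : nat) :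
  (#|cyclic_arc i k| <= k)%N.
Proof. by rewrite -[X in (_ <= X)%N](card_ord k) leq_imset_card. Qed.

(** Every edge start lies in a section deprived of its last vertex. *)
Lemma card_edge_starts (n : nat) (l : seq nat) (e : {set 'I_n}) :
  is_hyperedge_of_type l e -> (#|edge_starts e| <= \sum_(x <- l) x.-1)%N.
Proof.
case=> _ [s [sec_s _ def_e]].
have sub_e : edge_starts e \subset \bigcup_j cyclic_arc (s j) (nth 0%N l j).-1.
  apply/subsetP=> i; rewrite inE => /andP[i_e Si_e].
  move: (i_e); rewrite {1}def_e => /bigcupP[j _ /imsetP[k _ def_i]].
  apply/bigcupP; exists j => //.
  have /and4P[_ _ _ end_notin] := sec_s j.
  have lt_k : (k < (nth 0 l j).-1)%N.
    have lt_kl := ltn_ord k.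
    rewrite ltn_neqAle -ltnS (ltn_predK lt_kl) lt_kl andbT.
    (* If [i] were the last vertex of its section, [ordS i] would be the vertex just past it, which
       is outside [e]. *)
    apply: contra end_notin => /eqP def_k.
    by rewrite -(ltn_predK lt_kl) -def_k iterS -def_i.
  by apply/imsetP; exists (Ordinal lt_k).
apply: leq_trans (subset_leq_card sub_e) _.
rewrite (big_nth 0%N) big_mkord.
elim/big_rec2: _ => [|j m A _ le_A]; first by rewrite cards0.
apply: leq_trans (leq_card_setU _ _) _.
by rewrite leq_add ?card_cyclic_arc.
Qed.

Lemma two_hyperedges_at (n : nat) (E : hypergraph 'I_n) (i : 'I_n) :
  EI E = cycle_graph n -> (2 <= #|[set e in E | i \in edge_starts e]|)%N.
Proof.
move=> EI_E.
have : [set i; ordS i] \in EI E by rewrite EI_E; apply/imsetP; exists i.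
case/imset2P=> e1 e2 e1E; rewrite inE => /andP[e2E /andP[ne12 _]] def_i.
have [i1 i2] : i \in e1 /\ i \in e2.
  by apply/andP; rewrite -in_setI -def_i set21.
have [Si1 Si2] : ordS i \in e1 /\ ordS i \in e2.
  by apply/andP; rewrite -in_setI -def_i set22.
have -> : 2%N = #|[set e1; e2]| by rewrite cards2 ne12.
apply/subset_leq_card/subsetP=> e.
by rewrite !inE => /orP[] /eqP->; apply/and3P.
Qed.

Theorem theorem7 (n : nat) (E : hypergraph 'I_n) :
  (3 <= n)%N ->
  uniform 5 E ->
  EI E = cycle_graph n ->
  (forall e : {set 'I_n}, e \in E -> is_hyperedge_of_type [:: 3; 2]%N e) ->
  (2 * n%:R) / 3 <= #|E|%:R :> rat.
Proof.
move=> _ _ EI_E type_E.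
suff le_nE : (2 * n <= #|E| * 3)%N.
  by rewrite Num.Theory.ler_pdivrMr // -!GRing.natrM Num.Theory.ler_nat.
have count_i : (2 * n <= \sum_(i < n) #|[set e in E | i \in edge_starts e]|)%N.
  rewrite mulnC -[X in (X * _)%N](card_ord n) -sum_nat_const.
  by apply: leq_sum => i _; apply: two_hyperedges_at.
apply: leq_trans count_i _.
(* Moving the condition on [i] into the summand leaves independent ranges for [i] and [e], so the
   sums can be exchanged. *)
under eq_bigr do rewrite cardsE -sum1_card big_mkcondr.
rewrite exchange_big -sum_nat_const; apply: leq_sum => e eE.
rewrite -big_mkcond sum1_card.
(* The bound for sections 3 and 2 is 2 + 1 = 3. *)
by apply: leq_trans (card_edge_starts _ _ _ (type_E e eE)) _; rewrite !big_cons big_nil.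
Qed.
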